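(* Let $(\bar\vartheta_T,\bar\alpha_T,\bar\rho_T)\in\mathcal K$ satisfy $\mathcal C_T(\bar\vartheta_T,\bar\alpha_T,\bar\rho_T)\succeq 0$ and $\bar\alpha_T>0$, and let $\bar z_T$ be a weakest direction of this certificate, i.e. $\bar z_T\in\arg\max\{\|O^\top z\| : z\in\mathcal V_T,\ \|z\|=1\}$, with associated quantities $\bar a_T,\bar b_T,\bar c_T,\eta_T$ (all defined in the context). Suppose that for some $s\in\{+1,-1\}$ the second-order cone program $$\max_{u,t,\mu}\ \mu\quad\text{s.t.}\quad u\in\mathcal U,\quad \|\mathbf A_T^{-1/2}w_T(u)\|\le t,\quad s\,\bar c_T^\top w_T(u)-\eta_T t-\sqrt{\bar a_T^\top\Omega_T\bar a_T}\ \ge\ \mu$$ has a solution $(u_T^{\rm fd},t_T,\mu_T)$ with $\mu_T\ge 0$. Then for every $\Theta\in\Sigma_T$ and every future disturbance $e_T\in\mathbb R^n$ satisfying $e_Te_T^\top\preceq\Omega_T$, $$\left|\bar a_T^\top\bigl(\Theta w_T(u_T^{\rm fd})+e_T\bigr)-\bar b_T^\top w_T(u_T^{\rm fd})\right|\ge\mu_T .$$ Moreover, if $\mu_T\ge\sqrt{\bar a_T^\top\Omega_T\bar a_T}$, then $$\bar z_T^\top\,\mathcal C_{T+1}(\bar\vartheta_T,\bar\alpha_T,\bar\rho_T)\,\bar z_T\ \ge\ \bar z_T^\top\,\mathcal C_T(\bar\vartheta_T,\bar\alpha_T,\bar\rho_T)\,\bar z_T ,$$ where $\mathcal C_{T+1}$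 is formed from the data extended by the input $u_T^{\rm fd}$ and the next state $x_{T+1}=\Theta w_T(u_T^{\rm fd})+e_T$, for any such $\Theta$ and $e_T$.
   Context: Notation: for symmetric matrices $\succeq,\preceq,\succ$ denote the Loewner order; for $Q\succeq0$, $Q^{1/2}$ is the symmetric positive semidefinite square root and for $Q\succ 0$, $Q^{-1/2}=(Q^{1/2})^{-1}$; $\|\cdot\|$ is the Euclidean norm for vectors. Data. Let $p=n+m$. Measurements come from an unknown controllable system $x_{t+1}=A_\star x_t+B_\star u_t+e_t$, $x_t\in\mathbb R^n$, $u_t\in\mathbb R^m$, $e_t\in\mathbb R^n$ unmeasured. Put $X_T=[x_0\ \cdots\ x_{T-1}]$, $U_T=[u_0\ \cdots\ u_{T-1}]$, $Y_T=[x_1\ \cdots\ x_T]$, $E_T=[e_0\ \cdots\ e_{T-1}]$, $W_T=\begin{bmatrix}X_T\\ U_T\end{bmatrix}\in\mathbb R^{p\times T}$. Standing assumptions: $W_T$ has full row rank $p$; there are known symmetric matrices $\Delta_t\in\mathbb R^{n\times n}$ with $E_TE_T^\top\preceq\Delta_T$ for every $T$; with $\Omega_T:=\Delta_{T+1}-\Delta_T$, the disturbance at time $T$ satisfies $e_Te_T^\top\preceq\Omega_T$; the set $\mathcal U\subset\mathbb R^m$ of admissible inputs is compact (it is described by any combination of constraints of the form $\|u\|_\infty\le\bar u_\infty$, $\|u\|_2\le\bar u_2$, $(u-u_c)^\top H_u^{-1}(u-u_c)\le1$, $Gu\le g$). Data-consistent systems: $\Sigma_T=\{\Theta\in\mathbb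 R^{n\times p}:(Y_T-\Theta W_T)(Y_T-\Theta W_T)^\top\preceq\Delta_T\}$. Define $\mathbf A_T=W_TW_T^\top\succ0$, $\mathbf B_T=-W_TY_T^\top$, $\boldsymbol\zeta_T=-\mathbf A_T^{-1}\mathbf B_T\in\mathbb R^{p\times n}$, $\mathbf Q_T=\mathbf B_T^\top\mathbf A_T^{-1}\mathbf B_T-Y_TY_T^\top+\Delta_T\succeq0$. Certificate. Let $$N_T=\begin{bmatrix}\Delta_T&0\\ 0&0_p\end{bmatrix}-\begin{bmatrix}Y_T\\ -W_T\end{bmatrix}\begin{bmatrix}Y_T\\ -W_T\end{bmatrix}^\top\in\mathbb R^{(n+p)\times(n+p)},\qquad \mathcal C_T(\vartheta,\alpha,\rho)=\mathcal F(\vartheta,\rho)-\alpha\,O N_T O^\top,$$ where $\mathcal F$ is a data-independent symmetric-matrix-valued map, affine in the decision variables $\vartheta=(\vartheta_1,\dots,\vartheta_s)$ and in $\rho\in\mathbb R$; $O$ is a constant matrix with $n+p$ columns; $\alpha\ge0$ is a scalar multiplier. The set $\mathcal K$ is a data-independent constraint set for $(\vartheta,\alpha,\rho)$, all of whose elements have $\alpha\ge 0$. $\mathcal C_{T+1}$ is defined in the same way from the data over $[0,T+1]$, with $\Delta_{T+1}=\Delta_T+\Omega_T$. Next-step quantities: $x_T$ is known, and $w_T(u)=\begin{bmatrix}x_T\\ u\end{bmatrix}\in\mathbb R^p$ for $u\in\mathcal U$. Weakest direction. For the given certificate, let $\lambda_T^{\min}=\lambda_{\min}(\mathcal C_T(\bar\vartheta_T,\bar\alpha_T,\bar\rho_T))$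 and $\mathcal V_T=\ker(\mathcal C_T(\bar\vartheta_T,\bar\alpha_T,\bar\rho_T)-\lambda_T^{\min}I)$. Write $O^\top\bar z_T=\begin{bmatrix}\bar a_T\\ \bar b_T\end{bmatrix}$ with $\bar a_T\in\mathbb R^n$, $\bar b_T\in\mathbb R^p$, and set $\bar c_T=\boldsymbol\zeta_T\bar a_T-\bar b_T$, $\eta_T=\|\mathbf Q_T^{1/2}\bar a_T\|$. *)

(* Defs.v *)
From HB Require Import structures.
From mathcomp Require Import all_boot all_order all_algebra.
From mathcomp Require Import sesquilinear.
From mathcomp Require Import all_classical all_reals all_analysis.

Set Implicit Arguments.
Unset Strict Implicit.
Unset Printing Implicit Defensive.

Import Order.TTheory GRing.Theory Num.Theory.
Import numFieldNormedType.Exports.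

Local Open Scope classical_set_scope.
Local Open Scope ring_scope.

Section LinearAlgebra.
Context {R : realType}.

Definition dot k (v w : 'cV[R]_k) : R := (v^T *m w) 0 0.

(* The norm `|v| of the library on matrices is the sup norm. *)
Definition enorm k (v : 'cV[R]_k) : R := Num.sqrt (\sum_i v i 0 ^+ 2).

Definition qform k (M : 'M[R]_k) (v : 'cV[R]_k) : R := (v^T *m M *m v) 0 0.

Definition psd k (M : 'M[R]_k) : Prop :=
  M \is symmetricmx /\ forall v, 0 <= qform M v.

Definition loewner_le k (M N : 'M[R]_k) : Prop := psd (N - M).

(* The positive semidefinite square root is unique when it exists; junk value 0
   when it does not. *)
Definition psd_sqrt k (M : 'M[R]_k) : 'M[R]_k :=
  xget 0 [set S | psd S /\ S *m S = M].

(* For symmetric M of size k > 0 the spectrum is finite and nonempty, so that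
   the infimum is attained. *)
Definition lambda_min k (M : 'M[R]_k) : R := inf [set l | eigenvalue M l].

Definition controllable n m (A : 'M[R]_n) (B : 'M[R]_(n, m)) : Prop :=
  \rank (\mxrow_(i < n) ((A ^+ i : 'M[R]_n) *m B)) = n.

End LinearAlgebra.

Section Data.
Context {R : realType} {n m : nat}.

(* [v_0 ... v_{T-1}] *)
Definition data_mx k (v : nat -> 'cV[R]_k) (T : nat) : 'M[R]_(k, T) :=
  \matrix_(i < k, t < T) v t i 0.

Variables (Delta : nat -> 'M[R]_n).
Variables (x : nat -> 'cV[R]_n) (u : nat -> 'cV[R]_m) (T : nat).

Definition Wmx : 'M[R]_(n + m, T) := col_mx (data_mx x T) (data_mx u T).

Definition Ymx : 'M[R]_(n, T) := data_mx (fun t => x t.+1) T.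

Definition Omega : 'M[R]_n := Delta T.+1 - Delta T.

Definition Sigma : set 'M[R]_(n, n + m) :=
  [set Theta | loewner_le
     ((Ymx - Theta *m Wmx) *m (Ymx - Theta *m Wmx)^T) (Delta T)].

Definition bfA : 'M[R]_(n + m) := Wmx *m Wmx^T.

Definition bfB : 'M[R]_(n + m, n) := - (Wmx *m Ymx^T).

Definition zeta : 'M[R]_(n + m, n) := - (invmx bfA *m bfB).

Definition bfQ : 'M[R]_n :=
  bfB^T *m invmx bfA *m bfB - Ymx *m Ymx^T + Delta T.

Definition Nmx : 'M[R]_(n + (n + m)) :=
  block_mx (Delta T) 0 0 0 - col_mx Ymx (- Wmx) *m (col_mx Ymx (- Wmx))^T.

Definition next_w (v : 'cV[R]_m) : 'cV[R]_(n + m) := col_mx (x T) v.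

End Data.

Section Certificate.
Context {R : realType} {n m k q : nat}.

Definition affine_mx_map (F : 'rV[R]_k -> R -> 'M[R]_q) : Prop :=
  exists (F0 : 'M[R]_q) (Fi : 'I_k -> 'M[R]_q) (Frho : 'M[R]_q),
    forall theta rho,
      F theta rho = F0 + \sum_(i < k) theta 0 i *: Fi i + rho *: Frho.

Variables (F : 'rV[R]_k -> R -> 'M[R]_q) (O : 'M[R]_(q, n + (n + m))).
Variables (Delta : nat -> 'M[R]_n).
Variables (x : nat -> 'cV[R]_n) (u : nat -> 'cV[R]_m) (T : nat).

Definition cert (theta : 'rV[R]_k) (alpha rho : R) : 'M[R]_q :=
  F theta rho - alpha *: (O *m Nmx Delta x u T *m O^T).

Definition min_eigenspace (C : 'M[R]_q) : set 'cV[R]_q :=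
  [set z | (C - (lambda_min C)%:M) *m z = 0].

Definition weakest_direction (C : 'M[R]_q) (z : 'cV[R]_q) : Prop :=
  [/\ min_eigenspace C z, enorm z = 1 &
      forall z', min_eigenspace C z' -> enorm z' = 1 ->
        enorm (O^T *m z') <= enorm (O^T *m z)].

Definition dir_a (z : 'cV[R]_q) : 'cV[R]_n := usubmx (O^T *m z).

Definition dir_b (z : 'cV[R]_q) : 'cV[R]_(n + m) := dsubmx (O^T *m z).

Definition dir_c (z : 'cV[R]_q) : 'cV[R]_(n + m) :=
  zeta x u T *m dir_a z - dir_b z.

Definition dir_eta (z : 'cV[R]_q) : R :=
  enorm (psd_sqrt (bfQ Delta x u T) *m dir_a z).

Definition noise_margin (z : 'cV[R]_q) : R :=
  Num.sqrt (qform (Omega Delta T) (dir_a z)).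

Definition socp_feasible (U : set 'cV[R]_m) (z : 'cV[R]_q) (s : R)
    (v : 'cV[R]_m) (t mu : R) : Prop :=
  [/\ U v,
      enorm (invmx (psd_sqrt (bfA x u T)) *m next_w x T v) <= t &
      s * dot (dir_c z) (next_w x T v) - dir_eta z * t - noise_margin z >= mu].

Definition socp_solution (U : set 'cV[R]_m) (z : 'cV[R]_q) (s : R)
    (v : 'cV[R]_m) (t mu : R) : Prop :=
  socp_feasible U z s v t mu /\
  forall v' t' mu', socp_feasible U z s v' t' mu' -> mu' <= mu.

End Certificate.

(* Main.v *)
(* Completing the square shows that every [Theta] consistent with the data lies
   in the matrix ellipsoid [(Theta - zeta^T) A (Theta - zeta^T)^T <= Q]. By
   Cauchy-Schwarz in the metric of [A], the prediction [a^T Theta w] then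
   differs from [(zeta a)^T w] by at most [|Q^(1/2) a| |A^(-1/2) w|], and
   [e e^T <= Omega] gives [|a^T e| <= sqrt (a^T Omega a)]; this is the first
   claim. For the second, adding one sample changes the quadratic form of [N] at
   [O^T z] by [a^T Omega a - (a^T x_(T+1) - b^T w)^2], which is nonpositive once
   the prediction exceeds the noise margin. *)

Require Import Defs.
From HB Require Import structures.
From mathcomp Require Import all_boot all_order all_algebra.
From mathcomp Require Import sesquilinear spectral.
From mathcomp Require Import all_classical all_reals all_analysis.
From mathcomp Require Import complex ring lra.

Set Implicit Arguments.
Unset Strict Implicit.
Unset Printing Implicit Defensive.

Import Order.TTheory GRing.Theory Num.Theory.
Import numFieldNormedType.Exports.

Local Open Scope classical_set_scope.
Local Open Scope ring_scope.

(** * Symmetry as a transpose identity, and polynomial interpolation *)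

Lemma symmetricmxP (R : fieldType) k (M : 'M[R]_k) :
  reflect (M^T = M) (M \is symmetricmx).
Proof.
apply: (iffP (is_hermitianmxP _ _ _)); by rewrite expr0 scale1r map_mx_id.
Qed.

(** Newton's scheme: a new node [a] is fitted by adding a multiple of the product of the
    ['X - b%:P], which vanishes at all earlier nodes but not at [a]. *)
Lemma poly_interpolation (K : fieldType) (f : K -> K) (s : seq K) :
  exists p : {poly K}, {in s, forall a, p.[a] = f a}.
Proof.
elim: s => [|a s [p ps]]; first by exists 0.
have [sa|sNa] := boolP (a \in s).
  by exists p => b; rewrite inE => /predU1P[->|]; exact: ps.
pose h := \prod_(b <- s) ('X - b%:P).
have ha : h.[a] != 0 by rewrite -rootE root_prod_XsubC.
exists (p + ((f a - p.[a]) / h.[a]) *: h) => b.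
rewrite inE !hornerE => /predU1P[->|sb].
  by rewrite divfK// addrC subrK.
have /rootP-> : root h b by rewrite root_prod_XsubC.
by rewrite mulr0 addr0 ps.
Qed.

(** * Inner products, quadratic forms and square roots of matrices *)

Section QuadraticForms.
Context {R : realType}.

Lemma dotE k (v w : 'cV[R]_k) : dot v w = \sum_i v i 0 * w i 0.
Proof. by rewrite /dot mxE; apply: eq_bigr => i _; rewrite mxE. Qed.

Lemma dotvv_ge0 k (v : 'cV[R]_k) : 0 <= dot v v.
Proof. by rewrite dotE sumr_ge0// => i _; rewrite -expr2 sqr_ge0. Qed.

Lemma dotvv_eq0 k (v : 'cV[R]_k) : dot v v = 0 -> v = 0.
Proof.
rewrite dotE => /eqP; rewrite psumr_eq0 => [/allP v0|i _]; last first.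
  by rewrite -expr2 sqr_ge0.
apply/matrixP => i j; rewrite ord1 mxE.
by have /(_ (mem_index_enum i)) := v0 i; rewrite mulf_eq0 orbb => /eqP.
Qed.

Lemma enormE k (v : 'cV[R]_k) : enorm v = Num.sqrt (dot v v).
Proof. by rewrite /enorm dotE. Qed.

Lemma enorm_ge0 k (v : 'cV[R]_k) : 0 <= enorm v.
Proof. exact: sqrtr_ge0. Qed.

Lemma dot_mulmxl k l (M : 'M[R]_(k, l)) v w : dot (M *m v) w = dot v (M^T *m w).
Proof. by rewrite /dot trmx_mul mulmxA. Qed.

Lemma qform_gram k l (G : 'M[R]_(k, l)) v :
  qform (G *m G^T) v = dot (G^T *m v) (G^T *m v).
Proof. by rewrite /qform /dot trmx_mul trmxK !mulmxA. Qed.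

Lemma qformD k (M N : 'M[R]_k) v : qform (M + N) v = qform M v + qform N v.
Proof. by rewrite /qform mulmxDr mulmxDl mxE. Qed.

Lemma qformB k (M N : 'M[R]_k) v : qform (M - N) v = qform M v - qform N v.
Proof. by rewrite /qform mulmxBr mulmxBl mxE [X in _ + X]mxE. Qed.

Lemma loewner_le_qform k (M N : 'M[R]_k) v :
  loewner_le M N -> qform M v <= qform N v.
Proof. by move=> [_ /(_ v)]; rewrite qformB subr_ge0. Qed.

Lemma psd_eigenvalue_ge0 k (M : 'M[R]_k) a : psd M -> eigenvalue M a -> 0 <= a.
Proof.
move=> [_ M_ge0] /eigenvalueP[v vM v0].
have := M_ge0 v^T; rewrite /qform trmxK vM -scalemxAl mxE.
suff v_gt0 : 0 < (v *m v^T) 0 0 by rewrite pmulr_lge0.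
have -> : (v *m v^T) 0 0 = dot v^T v^T by rewrite /dot trmxK.
rewrite lt_neqAle dotvv_ge0 andbT eq_sym.
by apply: contra v0 => /eqP/dotvv_eq0/(congr1 trmx); rewrite trmxK trmx0 => ->.
Qed.

Lemma trmx_horner_mx k (M : 'M[R]_k.+1) p : (horner_mx M p)^T = horner_mx M^T p.
Proof.
elim/poly_ind: p => [|p c ihp]; first by rewrite !rmorph0 trmx0.
rewrite !rmorphD !rmorphM /= !horner_mx_X !horner_mx_C.
rewrite linearD /= tr_scalar_mx -[_ * M]/(_ *m M) trmx_mul ihp.
(* Transposition has reversed the product, and a polynomial in [M^T] commutes with [M^T]. *)
by congr (_ + _); apply: comm_mx_horner.
Qed.

(* The root is taken as [r(M)^2] with [r] a real polynomial sending every
   eigenvalue of [M] to its fourth root, so that it is positive semidefinite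
   because [r(M)] is symmetric. The complex spectral theorem shows that
   [r(M)^4 = M]. *)
Lemma psd_sqrt_exists k (M : 'M[R]_k) :
  psd M -> exists S, psd S /\ S *m S = M.
Proof.
case: k M => [|k] M psdM.
  (* [horner_mx] takes matrices of size [k.+1]; in size 0 all matrices are equal and [M] is its own
     root. *)
  by exists M; split; rewrite // [LHS]flatmx0 [RHS]flatmx0.
have /symmetricmxP Msym := psdM.1.
pose toC := real_complex R.
pose MC := map_mx toC M.
have MC_herm : MC \is hermsymmx.
  apply: realsym_hermsym; first by apply/symmetricmxP; rewrite map_trmx Msym.
  by apply/mxOverP => i j; rewrite mxE complex_real.
have MCE := orthomx_spectralP (hermitian_normalmx MC_herm).
set P := spectralmx MC in MCE; set d := spectral_diag MC in MCE.
have Punit : P \in unitmx := spectral_unit MC.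
have d_re i : d 0 i = toC (complex.Re (d 0 i)).
  have /mxOverP/(_ 0 i) := hermitian_spectral_diag_real MC_herm.
  by move=> /RRe_real.
(* Row [i] of [P] is a complex eigenvector for [d 0 i]. As this value is real, it descends to an
   eigenvalue of [M] over [R], hence is nonnegative. *)
have d_eigen i : eigenvalue M (complex.Re (d 0 i)).
  rewrite -(eigenvalue_map toC); apply/eigenvalueP; exists (row i P).
    rewrite -[X in _ = X *: _]/(toC _) -d_re -row_mul -/MC MCE.
    rewrite !mulmxA mulmxV// mul1mx.
    by rewrite row_mul row_diag_mx -scalemxAl -rowE.
  apply: contraTneq Punit => Pi0.
  rewrite unitmxE unitfE negbK (expand_det_row _ i) big1// => j _.
  by move/rowP/(_ j): Pi0; rewrite !mxE => ->; rewrite mul0r.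
have [r rE] := poly_interpolation (fun a => Num.sqrt (Num.sqrt a))
  [seq complex.Re (d 0 i) | i : 'I_k.+1].
pose S2 := horner_mx M r.
have S2sym : S2^T = S2 by rewrite trmx_horner_mx Msym.
exists (S2 *m S2); split.
  split; first by apply/symmetricmxP; rewrite trmx_mul !S2sym.
  by move=> v; rewrite -{2}S2sym qform_gram dotvv_ge0.
apply: (@map_mx_inj _ _ toC).
have -> : S2 *m S2 *m (S2 *m S2) = horner_mx M (r ^+ 4).
  by rewrite rmorphXn [RHS](exprM _ 2 2).
rewrite map_horner_mx -/MC.
rewrite MCE horner_mx_uconjC// horner_mx_diag.
congr (_ *m diag_mx _ *m _); apply/rowP => i; rewrite mxE.
rewrite rmorphXn /= horner_exp d_re horner_map rE ?codom_f//.
rewrite -rmorphXn (exprM _ 2 2) !sqr_sqrtr ?sqrtr_ge0//.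
exact: psd_eigenvalue_ge0 psdM (d_eigen i).
Qed.

(** Since a root exists, [xget] returns one and not its default 0. *)
Lemma psd_sqrtP k (M : 'M[R]_k) :
  psd M -> psd (psd_sqrt M) /\ psd_sqrt M *m psd_sqrt M = M.
Proof. by move=> /psd_sqrt_exists/(xgetPex 0). Qed.

Lemma enorm_psd_sqrt k (M : 'M[R]_k) v :
  psd M -> enorm (psd_sqrt M *m v) = Num.sqrt (qform M v).
Proof.
move=> /psd_sqrtP[[/symmetricmxP Ssym _] SS]; rewrite enormE dot_mulmxl Ssym.
by rewrite mulmxA SS /qform /dot mulmxA.
Qed.

Lemma psd_sqrt_unit k (M : 'M[R]_k) :
  psd M -> M \in unitmx -> psd_sqrt M \in unitmx.
Proof. by move=> /psd_sqrtP[_ SS]; rewrite -{1}SS unitmx_mul andbb. Qed.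

Lemma psdD k (M N : 'M[R]_k) : psd M -> psd N -> psd (M + N).
Proof.
move=> [/symmetricmxP Ms M0] [/symmetricmxP Ns N0]; split.
  by apply/symmetricmxP; rewrite linearD /= Ms Ns.
by move=> v; rewrite qformD addr_ge0.
Qed.

Lemma psd_gram k l (G : 'M[R]_(k, l)) : psd (G *m G^T).
Proof.
split; first by apply/symmetricmxP; rewrite trmx_mul trmxK.
by move=> v; rewrite qform_gram dotvv_ge0.
Qed.

(** If [v *m (G *m G^T) = 0], then [v *m G] has squared norm 0, and full row rank of [G] forces
    [v = 0]. *)
Lemma gram_unit k l (G : 'M[R]_(k, l)) : \rank G = k -> G *m G^T \in unitmx.
Proof.
move=> rG; rewrite -row_free_unit -kermx_eq0.
apply/eqP/row_matrixP => i; rewrite row0.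
have: row i (kermx (G *m G^T)) *m (G *m G^T) = 0.
  by rewrite -row_mul mulmx_ker row0.
move: (row i _) => v vGG; suff : v *m G == 0.
  by rewrite mulmx_free_eq0 ?/row_free ?rG// => /eqP.
rewrite -(inj_eq trmx_inj) trmx0; apply/eqP/dotvv_eq0.
by rewrite /dot trmxK trmx_mul mulmxA -(mulmxA v) vGG mul0mx mxE.
Qed.

Lemma dotC k (v w : 'cV[R]_k) : dot v w = dot w v.
Proof. by rewrite !dotE; apply: eq_bigr => i _; rewrite mulrC. Qed.

Lemma dotDl k (u v w : 'cV[R]_k) : dot (u + v) w = dot u w + dot v w.
Proof. by rewrite /dot linearD mulmxDl mxE. Qed.

Lemma dotDr k (u v w : 'cV[R]_k) : dot w (u + v) = dot w u + dot w v.
Proof. by rewrite /dot mulmxDr mxE. Qed.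

Lemma dotZl k a (v w : 'cV[R]_k) : dot (a *: v) w = a * dot v w.
Proof. by rewrite /dot linearZ -scalemxAl mxE. Qed.

Lemma dotZr k a (v w : 'cV[R]_k) : dot v (a *: w) = a * dot v w.
Proof. by rewrite /dot -scalemxAr mxE. Qed.

Lemma dotNl k (v w : 'cV[R]_k) : dot (- v) w = - dot v w.
Proof. by rewrite /dot linearN mulNmx mxE. Qed.

Lemma normr_dot_le k (v w : 'cV[R]_k) : `|dot v w| <= enorm v * enorm w.
Proof.
rewrite !enormE -sqrtrM ?dotvv_ge0// -sqrtr_sqr ler_sqrt; last first.
  by rewrite mulr_ge0 ?dotvv_ge0.
have [vv0|vvN0] := eqVneq (dot v v) 0.
  by rewrite (dotvv_eq0 vv0) /dot trmx0 !mul0mx !mxE expr0n mul0r.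
have vv_gt0 : 0 < dot v v by rewrite lt_neqAle eq_sym vvN0 dotvv_ge0.
(* This vector is [dot v v] times the component of [w] orthogonal to [v]. Its squared norm is
   [a * (a * c - b ^+ 2)], with [a > 0]. *)
have := dotvv_ge0 (dot v v *: w + (- dot v w) *: v).
rewrite !(dotDl, dotDr, dotZl, dotZr) (dotC w v).
set a := dot v v; set b := dot v w; set c := dot w w => h.
rewrite -subr_ge0 -(pmulr_rge0 _ vv_gt0) -/a.
by apply: le_trans h _; rewrite le_eqVlt; apply/orP; left; apply/eqP; ring.
Qed.

End QuadraticForms.

(** * The data as a sum over samples, and the ellipsoid of consistent systems *)

Section DataForms.
Context {R : realType} {n m : nat}.
Variables (Delta : nat -> 'M[R]_n).
Variables (x : nat -> 'cV[R]_n) (u : nat -> 'cV[R]_m).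

Lemma WmxE T : Wmx x u T = data_mx (fun t => col_mx (x t) (u t)) T.
Proof.
apply/matrixP => i t; rewrite !mxE.
by case: splitP => j _; rewrite mxE.
Qed.

Lemma data_mxT_mul k (v : nat -> 'cV[R]_k) T a (t : 'I_T) :
  ((data_mx v T)^T *m a) t 0 = dot a (v t).
Proof.
by rewrite mxE dotE; apply: eq_bigr => i _; rewrite !mxE mulrC.
Qed.

(** Written sample by sample, so that extending the data adds a single square. *)
Lemma qform_Nmx T (h : 'cV[R]_(n + (n + m))) :
  qform (Nmx Delta x u T) h = qform (Delta T) (usubmx h) -
    \sum_(t < T) (dot (usubmx h) (x t.+1)
                  - dot (dsubmx h) (col_mx (x t) (u t))) ^+ 2.
Proof.
rewrite -{1}(vsubmxK h); move: (usubmx h) (dsubmx h) => a b.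
rewrite qformB qform_gram; congr (_ - _).
  rewrite /qform tr_col_mx mul_row_block !mulmx0 !addr0 mul_row_col.
  by rewrite mul0mx addr0.
rewrite tr_col_mx mul_row_col WmxE linearN mulNmx /= dotE.
by apply: eq_bigr => t _; rewrite -expr2 mxE [X in _ + X]mxE !data_mxT_mul.
Qed.

Lemma Sigma_ellipsoid T Theta (D := Theta - (zeta x u T)^T) :
  \rank (Wmx x u T) = (n + m)%N -> Sigma Delta x u T Theta ->
  loewner_le (D *m bfA x u T *m D^T) (bfQ Delta x u T).
Proof.
move=> /gram_unit; rewrite /Sigma /loewner_le /= /bfQ {}/D /zeta -/(bfA x u T).
have BT : (bfB x u T)^T = - (Ymx x T *m (Wmx x u T)^T).
  by rewrite linearN /= trmx_mul trmxK.
have AT : (bfA x u T)^T = bfA x u T by rewrite trmx_mul trmxK.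
have -> : (- (invmx (bfA x u T) *m bfB x u T))^T
    = - ((bfB x u T)^T *m invmx (bfA x u T)).
  by rewrite linearN /= trmx_mul trmx_inv AT.
move: (erefl (bfA x u T)) (erefl (bfB x u T)) BT AT; rewrite {2}/bfA {2}/bfB.
move: (bfA x u T) (bfB x u T) (Wmx x u T) (Ymx x T) (Delta T) => A B W Y Dl.
move=> AE BE BT AT Aunit; rewrite opprK.
set lhs := (X in psd X -> _); set rhs := (X in _ -> psd X).
(* Completing the square is exact: [Q - D A D^T] and [Delta - (Y - Theta W)(Y - Theta W)^T] are the
   same matrix. *)
suff -> : rhs = lhs by [].
have DT : (Theta + B^T *m invmx A)^T = Theta^T + invmx A *m B.
  by rewrite linearD /= trmx_mul trmxK trmx_inv AT.
have YT : (Y - Theta *m W)^T = Y^T - W^T *m Theta^T.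
  by rewrite linearB /= trmx_mul.
have DAD : (Theta + B^T *m invmx A) *m A *m (Theta + B^T *m invmx A)^T
    = Theta *m A *m Theta^T + Theta *m B + B^T *m Theta^T
      + B^T *m invmx A *m B.
  rewrite DT mulmxDl mulmxKV// mulmxDl !mulmxDr !mulmxA mulmxK//.
  by rewrite !addrA.
have YY : (Y - Theta *m W) *m (Y - Theta *m W)^T
    = Y *m Y^T + B^T *m Theta^T + Theta *m B + Theta *m A *m Theta^T.
  rewrite YT mulmxBl !mulmxBr BT BE AE mulmxN mulNmx !mulmxA.
  by rewrite opprB addrA [in LHS]addrAC.
rewrite /rhs /lhs DAD YY; by apply/matrixP => i j; rewrite !mxE; ring.
Qed.

End DataForms.

(** * Prediction error bounds and the update of the certificate *)

Section NextStep.
Context {R : realType} {n m : nat}.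
Variables (Delta : nat -> 'M[R]_n).
Variables (x : nat -> 'cV[R]_n) (u : nat -> 'cV[R]_m) (T : nat).

Lemma normr_dot_noise_le (Om : 'M[R]_n) (a e : 'cV[R]_n) :
  loewner_le (e *m e^T) Om -> `|dot a e| <= Num.sqrt (qform Om a).
Proof.
move=> /(@loewner_le_qform _ _ _ _ a); rewrite qform_gram => le_qf.
rewrite -sqrtr_sqr ler_wsqrtr//; apply: le_trans le_qf.
by rewrite [leRHS]dotE big_ord1 -expr2 dotC.
Qed.

Lemma Sigma_deviation_le (Theta : 'M[R]_(n, n + m)) a w :
  \rank (Wmx x u T) = (n + m)%N -> Sigma Delta x u T Theta ->
  `|dot a (Theta *m w) - dot (zeta x u T *m a) w| <=
  enorm (psd_sqrt (bfQ Delta x u T) *m a) *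
  enorm (invmx (psd_sqrt (bfA x u T)) *m w).
Proof.
move=> rW ThetaS; have ellipsoid := Sigma_ellipsoid rW ThetaS.
set D := Theta - (zeta x u T)^T in ellipsoid.
have Apsd : psd (bfA x u T) := psd_gram _.
(* [Q] dominates the Gram matrix [D A D^T] of a consistent system. *)
have Qpsd : psd (bfQ Delta x u T).
  rewrite -[bfQ _ _ _ _](subrK (D *m bfA x u T *m D^T)).
  apply: psdD ellipsoid _.
  have -> : D *m bfA x u T *m D^T = (D *m Wmx x u T) *m (D *m Wmx x u T)^T.
    by rewrite trmx_mul !mulmxA.
  exact: psd_gram.
have Sunit := psd_sqrt_unit Apsd (gram_unit rW).
have [/symmetricmxP Ssym _] := (psd_sqrtP Apsd).1.
(* The difference is [dot (D^T *m a) w]; inserting [A^(1/2) A^(-1/2)] prepares Cauchy-Schwarz. *)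
have -> : dot a (Theta *m w) - dot (zeta x u T *m a) w
    = dot (psd_sqrt (bfA x u T) *m (D^T *m a))
          (invmx (psd_sqrt (bfA x u T)) *m w).
  rewrite [RHS]dot_mulmxl Ssym mulKVmx// !dot_mulmxl trmxK.
  by rewrite /D mulmxBl dotDr [dot a (- _)]dotC dotNl [dot _ a]dotC.
apply: le_trans (normr_dot_le _ _) _; rewrite ler_wpM2r ?enorm_ge0//.
rewrite !enorm_psd_sqrt// ler_wsqrtr//.
have -> : qform (bfA x u T) (D^T *m a) = qform (D *m bfA x u T *m D^T) a.
  by rewrite /qform trmx_mul trmxK !mulmxA.
exact: loewner_le_qform.
Qed.

Lemma qform_Nmx_next (xnext : 'cV[R]_n) (v : 'cV[R]_m)
    (h : 'cV[R]_(n + (n + m))) :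
  qform (Nmx Delta [eta x with T.+1 |-> xnext] [eta u with T |-> v] T.+1) h =
  qform (Nmx Delta x u T) h + qform (Omega Delta T) (usubmx h)
    - (dot (usubmx h) xnext - dot (dsubmx h) (next_w x T v)) ^+ 2.
Proof.
rewrite !qform_Nmx big_ord_recr /= !eqxx ltn_eqF//.
(* For samples [t < T] the indices [t] and [t.+1] miss the updated entries, namely the state at
   [T.+1] and the input at [T]. *)
under eq_bigr => t _ do rewrite /= eqSS !ltn_eqF ?ltnS ?(ltnW (ltn_ord t))//.
by rewrite /Omega qformB /next_w; ring.
Qed.

Lemma qform_cert k q (F : 'rV[R]_k -> R -> 'M[R]_q) (O : 'M[R]_(q, n + (n + m)))
    theta alpha rho z :
  qform (cert F O Delta x u T theta alpha rho) z =
  qform (F theta rho) z - alpha * qform (Nmx Delta x u T) (O^T *m z).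
Proof.
rewrite /cert qformB; congr (_ - _).
by rewrite /qform -scalemxAr -scalemxAl mxE trmx_mul trmxK !mulmxA.
Qed.

End NextStep.

Theorem theorem1 (R : realType) (n m k q : nat)
  (* data-independent ingredients *)
  (F : 'rV[R]_k -> R -> 'M[R]_q) (O : 'M[R]_(q, n + (n + m)))
  (K : set ('rV[R]_k * R * R)) (U : set 'cV[R]_m)
  (F_sym : forall theta rho, F theta rho \is symmetricmx)
  (F_affine : affine_mx_map F)
  (K_ge0 : forall theta alpha rho, K (theta, alpha, rho) -> 0 <= alpha)
  (U_compact : compact U)
  (* system, noise bounds and data up to time T *)
  (Astar : 'M[R]_n) (Bstar : 'M[R]_(n, m))
  (AB_ctrl : controllable Astar Bstar)
  (Delta : nat -> 'M[R]_n)
  (Delta_sym : forall t, Delta t \is symmetricmx)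
  (x : nat -> 'cV[R]_n) (u : nat -> 'cV[R]_m) (e : nat -> 'cV[R]_n) (T : nat)
  (dynamics : forall t, (t < T)%N ->
     x t.+1 = Astar *m x t + Bstar *m u t + e t)
  (E_bound : forall t, (t <= T)%N ->
     loewner_le (data_mx e t *m (data_mx e t)^T) (Delta t))
  (e_bound : forall t, (t < T)%N ->
     loewner_le (e t *m (e t)^T) (Omega Delta t))
  (W_rank : \rank (Wmx x u T) = (n + m)%N)
  (* certificate and weakest direction *)
  (theta : 'rV[R]_k) (alpha rho : R)
  (in_K : K (theta, alpha, rho))
  (cert_psd : psd (cert F O Delta x u T theta alpha rho))
  (alpha_gt0 : 0 < alpha)
  (z : 'cV[R]_q)
  (z_weakest : weakest_direction O (cert F O Delta x u T theta alpha rho) z)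
  (* solution of the second-order cone program *)
  (s : R) (s_sign : s = 1 \/ s = -1)
  (ufd : 'cV[R]_m) (t mu : R)
  (ufd_sol : socp_solution O Delta x u T U z s ufd t mu)
  (mu_ge0 : 0 <= mu) :
  (forall (Theta : 'M[R]_(n, n + m)) (eT : 'cV[R]_n),
     Sigma Delta x u T Theta ->
     loewner_le (eT *m eT^T) (Omega Delta T) ->
     `| dot (dir_a O z) (Theta *m next_w x T ufd + eT)
        - dot (dir_b O z) (next_w x T ufd) | >= mu)
  /\
  (mu >= noise_margin O Delta T z ->
   forall (Theta : 'M[R]_(n, n + m)) (eT : 'cV[R]_n),
     Sigma Delta x u T Theta ->
     loewner_le (eT *m eT^T) (Omega Delta T) ->
     let xnext := Theta *m next_w x T ufd + eT in
     qform (cert F O Delta [eta x with T.+1 |-> xnext] [eta u with T |-> ufd]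
              T.+1 theta alpha rho) z
     >= qform (cert F O Delta x u T theta alpha rho) z).
Proof.
have prediction_ge Theta eT : Sigma Delta x u T Theta ->
    loewner_le (eT *m eT^T) (Omega Delta T) ->
    mu <= `|dot (dir_a O z) (Theta *m next_w x T ufd + eT)
            - dot (dir_b O z) (next_w x T ufd)|.
  move=> ThetaS /(normr_dot_noise_le (dir_a O z)).
  rewrite -/(noise_margin O Delta T z) => noise.
  have [[_ w_le mu_le] _] := ufd_sol.
  have := Sigma_deviation_le (dir_a O z) (next_w x T ufd) W_rank ThetaS.
  move=> /le_trans/(_ (ler_wpM2l (enorm_ge0 _) w_le)) dev.
  move: mu_le; rewrite /dir_c /dir_eta dotDl dotNl dotDr.
  move: dev noise; rewrite !ler_norml.
  move=> /andP[? ?] /andP[? ?]; rewrite ler_normr.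
  (* The residual is [dot (dir_c O x u T z) w] up to errors of at most [eta * t] and the noise
     margin. The sign [s] decides whether the residual or its opposite is at least [mu]. *)
  by case: s_sign => -> ?; apply/orP; [left|right]; lra.
split=> // margin_le Theta eT ThetaS eT_le; cbv zeta.
rewrite !qform_cert qform_Nmx_next -/(dir_a O z) -/(dir_b O z).
(* [Omega] dominates [eT *m eT^T], so the root in [noise_margin] is a true one and its square gives
   back the form. *)
have Om_ge0 : 0 <= qform (Omega Delta T) (dir_a O z).
  by apply: le_trans (loewner_le_qform _ eT_le); rewrite qform_gram dotvv_ge0.
have {}margin_le := le_trans margin_le (prediction_ge _ _ ThetaS eT_le).
(* The [F] terms cancel and [alpha] factors out, leaving the form of [Omega] to be bounded by the
   squared residual. *)
rewrite lerD2l lerN2 ler_wpM2l ?(ltW alpha_gt0)// -addrA gerDl subr_le0.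
rewrite -(sqr_sqrtr Om_ge0) -[leRHS]real_normK ?num_real//.
by rewrite lerXn2r ?nnegrE ?sqrtr_ge0.
Qed.
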